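(* Let $k\ge 0$ be an integer, $p>2\max\{k\}+1$, $q>-1$ and $\upsilon=1,2,\dots$. For $\left|\frac{w^{\upsilon}}{a^{\upsilon}}\right|<1$, the Laplace transform (in the variable $z$, with transform variable $a$) of the finite bivariate M-Konhauser polynomials is $$\mathcal{L}\left\{z^{-p-q}\;{}_{K}M_{k;\upsilon}^{(p,q)}(y,wz)\right\}=(q+1)_k\,a^{p+q-1}\left(\frac{w^{\upsilon}-a^{\upsilon}}{a^{\upsilon}}\right)^{k}{}_2F_1\!\left[\begin{matrix}-k,\;k+1-p\\ q+1\end{matrix};\,\frac{y\,a^{\upsilon}}{w^{\upsilon}-a^{\upsilon}}\right].$$
   Context: $(a)_n=a(a+1)\cdots(a+n-1)$, $(a)_0=1$, and ${}_2F_1$ is the Gauss hypergeometric function. The Laplace transform of a one-variable function $f$ at $a$ is $\mathcal{L}[f](a)=\int_0^\infty e^{-a\xi}f(\xi)\,d\xi$, $\mathrm{Re}(a)>0$. For $p>2\max\{k\}+1$ (with $\max\{k\}$ the largest degree $k$ considered), $q>-1$ and $\upsilon=1,2,\dots$, the finite bivariate M-Konhauser polynomials are $${}_{K}M_{k;\upsilon}^{(p,q)}(y,z)=(-1)^k\Gamma(k+q+1)\sum_{l=0}^{k}\sum_{s=0}^{k-l}\frac{(-k)_{l+s}(k+1-p)_l(-y)^l z^{\upsilon s}}{\Gamma(l+q+1)\Gamma(\upsilon s-p-q+1)\,l!\,s!}.$$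
   Formalization: The Laplace integral is taken as Hadamard's finite part at 0 (equal to the ordinary integral when that converges), since it generally diverges for k≥1; the Γ(υs−p−q+1), s≤k, are assumed not at poles (p+q not an integer), since otherwise the formula fails. *)

(* Defs.v *)
From Stdlib Require Import Reals ZArith List Lra.
From Coquelicot Require Import Coquelicot.
Open Scope R_scope.

Fixpoint poch (x : R) (n : nat) : R :=
  match n with
  | O => 1
  | S m => poch x m * (x + INR m)
  end.

Definition Euler_Gamma (x : R) : R :=
  RInt_gen (fun t => exp (- t) * Rpower t (x - 1))
           (at_right 0) (Rbar_locally p_infty).

(* Continuation of the Euler integral by Gamma(x) = Gamma(x+n) / (x)_n, where n
   is the least natural number with x + n > 0 (so n = 0 when x > 0).  At the
   poles the value is the junk value 0. *)
Definition Gamma (x : R) : R :=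
  let n := Z.to_nat (up (- x)) in Euler_Gamma (x + INR n) / poch x n.

Definition Gamma_pole (x : R) : Prop := exists n : nat, x = - INR n.

Definition Cexp (z : C) : C :=
  (exp (Re z) * cos (Im z), exp (Re z) * sin (Im z)).

(* Principal branch of a^s.  The formula for the argument is the right one only
   on the half-plane Re a > 0, the only place where it is used. *)
Definition Crpower (a : C) (s : R) : C :=
  Cexp (RtoC s * (ln (Cmod a), atan (Im a / Re a)))%C.

(* Sum of the Gauss series, computed on real and imaginary parts because
   [Series] is real-valued. *)
Definition hyp2F1 (a b c : R) (x : C) : C :=
  let t n :=
    (RtoC (poch a n * poch b n / (poch c n * INR (fact n))) * x ^ n)%C in
  (Series (fun n => Re (t n)), Series (fun n => Im (t n))).

Definition M_Konhauser (k v : nat) (p q : R) (y z : C) : C :=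
  (RtoC ((-1) ^ k * Gamma (INR k + q + 1)) *
   sum_n (fun l => sum_n (fun s =>
     RtoC (poch (- INR k) (l + s) * poch (INR k + 1 - p) l /
           (Gamma (INR l + q + 1) * Gamma (INR (v * s) - p - q + 1)
            * INR (fact l) * INR (fact s)))
     * (- y) ^ l * z ^ (v * s)) (k - l)) k)%C.

Definition power_sum (cs : list (C * R)) (e : R) : C :=
  fold_right (fun t acc => fst t * RtoC (Rpower e (- snd t)) + acc)%C
             (RtoC 0) cs.

(* [is_laplace f a L]: L is the value of the integral of e^(-a x) f(x) over
   (0, +oo), where a divergence at 0 is resolved by Hadamard's finite part: the
   integral over [e, M] equals L + sum_i c_i e^(-mu_i) + o(1) as e -> 0+ and
   M -> +oo, for finitely many c_i and mu_i > 0.  With no c_i this unfolds to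
   [is_RInt_gen], the ordinary improper integral.  The finite part of
   x^s e^(-a x) is the value Gamma(s+1) a^(-s-1) of the analytic continuation
   in s, for s not a negative integer. *)
Definition is_laplace (f : R -> C) (a L : C) : Prop :=
  exists cs : list (C * R),
    (forall t, In t cs -> 0 < snd t) /\
    filterlimi
      (fun (b : R * R) (I : C) =>
         is_RInt (V := C_R_NormedModule)
           (fun x => Cexp (- (a * RtoC x)) * f x)%C
           (fst b) (snd b) (I + power_sum cs (fst b))%C)
      (filter_prod (at_right 0) (Rbar_locally p_infty))
      (locally (T := C_R_NormedModule) L).

Lemma is_laplace_of_improper (f : R -> C) (a L : C) :
  is_RInt_gen (V := C_R_NormedModule)
    (fun x => Cexp (- (a * RtoC x)) * f x)%C
    (at_right 0) (Rbar_locally p_infty) L ->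
  is_laplace f a L.
Proof.
intros H. exists nil. split; [intros t []|].
intros P HP. generalize (H P HP). unfold filtermapi. apply filter_imp.
intros b [I [HI HPI]]. exists I. split; [|exact HPI].
simpl. rewrite Cplus_0_r. exact HI.
Qed.

Lemma power_sum_app cs ds e :
  power_sum (cs ++ ds) e = (power_sum cs e + power_sum ds e)%C.
Proof.
induction cs as [|t cs IH]; simpl.
- now rewrite Cplus_0_l.
- rewrite IH. apply Cplus_assoc.
Qed.

Lemma power_sum_opp cs e :
  power_sum (map (fun t => (- fst t, snd t)%C) cs) e = (- power_sum cs e)%C.
Proof.
induction cs as [|t cs IH]; simpl.
- apply injective_projections; simpl; ring.
- rewrite IH. ring.
Qed.

Lemma power_sum_half m cs :
  exists ds, map snd ds = map snd cs /\
  forall e, 0 < e ->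
    (power_sum cs (e / 2) + RtoC (- Rpower 2 m) * power_sum cs e)%C
    = power_sum ds e.
Proof.
induction cs as [|t cs [ds [H1 H2]]].
- exists nil. split; [reflexivity|]. intros x _. simpl. ring.
- exists ((fst t * RtoC (Rpower 2 (snd t) - Rpower 2 m), snd t)%C :: ds).
  split; [simpl; now rewrite H1|].
  intros x Hx. simpl. rewrite <- (H2 x Hx).
  replace (Rpower (x / 2) (- snd t))
    with (Rpower 2 (snd t) * Rpower x (- snd t)).
  + rewrite RtoC_minus, RtoC_mult, RtoC_opp. ring.
  + unfold Rpower. rewrite <- exp_plus. f_equal.
    unfold Rdiv. rewrite ln_mult, ln_Rinv by lra. ring.
Qed.

Lemma power_sum_lim_0 ms : forall cs (l : C),
  map snd cs = ms -> (forall m, In m ms -> 0 < m) ->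
  filterlim (power_sum cs) (at_right 0) (locally (T := C_R_NormedModule) l) ->
  l = RtoC 0.
Proof.
induction ms as [|m ms IH]; intros cs l Hcs Hms Hl.
- destruct cs; [|discriminate].
  apply (filterlim_locally_unique (V := C_R_NormedModule) _ l (RtoC 0) Hl).
  apply (filterlim_const (F := at_right 0) (RtoC 0 : C_R_NormedModule)).
- destruct cs as [|[c m'] cs]; [discriminate|].
  injection Hcs as Hm Hcs. simpl in Hm. subst m'.
  destruct (power_sum_half m cs) as [ds [H1 H2]].
  assert (H2m : 1 < Rpower 2 m).
  { rewrite <- (Rpower_O 2) by lra. apply Rpower_lt; [lra|].
    apply Hms. now left. }
  assert (Hlim : plus (G := C_R_NormedModule) l
            (scal (V := C_R_NormedModule) (- Rpower 2 m) l) = RtoC 0).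
  { apply (IH ds); [now rewrite H1 | intros; apply Hms; now right |].
    apply filterlim_within_ext with
      (fun e => plus (G := C_R_NormedModule) (power_sum ((c, m) :: cs) (e / 2))
         (scal (V := C_R_NormedModule) (- Rpower 2 m)
            (power_sum ((c, m) :: cs) e))).
    { intros e He. rewrite <- (H2 e He).
      change (power_sum ((c, m) :: cs) (e / 2)
              + scal (V := C_R_NormedModule) (- Rpower 2 m)%R
                  (power_sum ((c, m) :: cs) e) =
              power_sum cs (e / 2) + RtoC (- Rpower 2 m) * power_sum cs e)%C.
      rewrite scal_R_Cmult. simpl.
      replace (Rpower (e / 2) (- m)) with (Rpower 2 m * Rpower e (- m)).
      - rewrite RtoC_mult, RtoC_opp. ring.
      - unfold Rpower. rewrite <- exp_plus. f_equal.
        unfold Rdiv. rewrite ln_mult, ln_Rinv by lra. ring. }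
    apply (filterlim_comp_2 (F := at_right 0)
             (G := locally (T := C_R_NormedModule) l)
             (H := locally (T := C_R_NormedModule)
                     (scal (V := C_R_NormedModule) (- Rpower 2 m) l))).
    - apply (filterlim_comp _ _ _ (fun e => e / 2) (power_sum ((c, m) :: cs))
               _ (at_right 0)); [|exact Hl].
      intros P [d Hd]. exists d. intros e He Hpos. apply Hd; [|lra].
      revert He. unfold ball; simpl; unfold AbsRing_ball, abs, minus, plus, opp;
      simpl. intros He. apply Rabs_def2 in He. apply Rabs_def1; lra.
    - apply (filterlim_comp _ _ _ (power_sum ((c, m) :: cs))
               (scal (V := C_R_NormedModule) (- Rpower 2 m))
               _ (locally (T := C_R_NormedModule) l)); [exact Hl|].
      apply (filterlim_scal_r (K := R_AbsRing) (V := C_R_NormedModule)).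
    - apply filterlim_plus. }
  assert (Hfst := f_equal fst Hlim). assert (Hsnd := f_equal snd Hlim).
  destruct l as [lr li].
  unfold plus, scal in Hfst, Hsnd. simpl in Hfst, Hsnd.
  unfold plus, scal in Hfst, Hsnd. simpl in Hfst, Hsnd.
  unfold mult in Hfst, Hsnd. simpl in Hfst, Hsnd.
  apply injective_projections; simpl;
    (apply (Rmult_eq_reg_l (1 - Rpower 2 m)); lra).
Qed.

Lemma is_laplace_unique (f : R -> C) (a L1 L2 : C) :
  is_laplace f a L1 -> is_laplace f a L2 -> L1 = L2.
Proof.
intros [cs [Hcs H1]] [ds [Hds H2]].
set (es := ds ++ map (fun t => (- fst t, snd t)%C) cs).
assert (HL : filterlim (power_sum es) (at_right 0)
               (locally (T := C_R_NormedModule)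
                  (minus (G := C_R_NormedModule) L1 L2))).
{ intros P HP.
  assert (HM := filterlim_comp_2 (V := C_R_NormedModule)
    (fun x : C_R_NormedModule * C_R_NormedModule => fst x)
    (fun x : C_R_NormedModule * C_R_NormedModule =>
       opp (G := C_R_NormedModule) (snd x))
    (plus (G := C_R_NormedModule))
    (F := filter_prod (locally (T := C_R_NormedModule) L1)
                      (locally (T := C_R_NormedModule) L2))
    filterlim_fst
    (filterlim_comp _ _ _ snd (opp (G := C_R_NormedModule)) _ _ _
       filterlim_snd (filterlim_opp (K := R_AbsRing) (V := C_R_NormedModule) L2))
    (filterlim_plus (K := R_AbsRing) (V := C_R_NormedModule) L1 _)).
  destruct (HM P HP) as [P1 P2 HP1 HP2 HP12].
  destruct (H1 P1 HP1) as [Q1 R1 HQ1 HR1 HQR1].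
  destruct (H2 P2 HP2) as [Q2 R2 HQ2 HR2 HQR2].
  destruct (filter_ex _ (filter_and _ _ HR1 HR2)) as [M [HM1 HM2]].
  generalize (filter_and _ _ HQ1 HQ2). unfold filtermap. apply filter_imp.
  intros e [He1 He2].
  destruct (HQR1 e M He1 HM1) as [I1 [HI1 HPI1]].
  destruct (HQR2 e M He2 HM2) as [I2 [HI2 HPI2]].
  simpl in HI1, HI2.
  assert (E : (I1 + power_sum cs e = I2 + power_sum ds e)%C).
  { exact (filterlim_locally_unique (V := C_R_NormedModule) _ _ _ HI1 HI2). }
  replace (power_sum es e) with (I1 - I2)%C; [exact (HP12 I1 I2 HPI1 HPI2)|].
  unfold es. rewrite power_sum_app, power_sum_opp.
  replace (power_sum ds e) with (I1 + power_sum cs e - I2)%C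
    by (rewrite E; ring).
  ring. }
assert (H0 : (L1 - L2)%C = RtoC 0).
{ refine (power_sum_lim_0 (map snd es) es _ eq_refl _ HL).
  intros m Hm. apply in_map_iff in Hm. destruct Hm as [t [<- Ht]].
  unfold es in Ht. apply in_app_or in Ht. destruct Ht as [Ht|Ht];
    [now apply Hds|].
  apply in_map_iff in Ht. destruct Ht as [u [<- Hu]]. simpl; now apply Hcs. }
assert (H : L1 = (L1 - L2 + L2)%C).
{ unfold Cminus. rewrite <- Cplus_assoc, (Cplus_comm (- L2)), Cplus_opp_r.
  now rewrite Cplus_0_r. }
rewrite H, H0. apply Cplus_0_l.
Qed.

(* Main.v *)
Require Import Defs.
From Stdlib Require Import Reals Factorial Lra Lia List.
From Coquelicot Require Import Coquelicot.
Open Scope R_scope.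

(** The transform is taken term by term.  For [x] away from the poles of Gamma,
    [finite_part_power] gives
      f.p. of the integral of e^(-a z) z^(x-1) over (0, oo) = Gamma(x) a^(-x),
    and the factor Gamma(v s - p - q + 1) so produced cancels the one in the
    denominator of the coefficient of z^(v s).  With u = w^v / a^v, what is left
    of the sum over s is the sum of (-(k-l))_s u^s / s!, which is (1 - u)^(k-l)
    by the binomial theorem ([binomial_theorem_neg]).  The sum over l is then
    the terminating Gauss series at y / (u - 1), once
    Gamma(k+q+1) / Gamma(l+q+1) is written as (q+1)_k / (q+1)_l.  The condition
    |u| < 1 ensures that u - 1 is not zero.

    All the analysis is in [finite_part_power].  Write a = r e^(i th) with
    |th| < pi/2.  The real and imaginary parts of z^s e^(-a z) are both of the
    form z^s e^(-r z cos th) cos(d - r z sin th), with d = 0 and d = -pi/2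
    ([Cexp_wave]).  Keeping the phase d as a parameter makes this family of real
    functions, called [kernel] below, stable under the derivatives in z and in
    th, so that complex differentiation is not needed.

    For x > 0 the integral converges, and one compares it with its value for
    th = 0, a rescaled Gamma integral.  This is the rotation of the contour of
    integration in differential form: along the ray, the derivative of the
    integrand in th is a derivative in z ([is_derive_kernel_angle]), so the
    derivative in th of the integral over [e, M] consists of two boundary terms,
    and these tend to 0 as e -> 0 and M -> oo ([RInt_kernel_rotate]).

    For other x one descends from x + 1 to x by parts ([finite_part_kernel]).
    The boundary term e^(-a z) z^x diverges at 0, but a Taylor expansion of the
    exponential shows that it is a combination of powers of z with nonzero
    exponents, up to a remainder that tends to 0 ([has_polar_part_kernel]); the
    finite part discards it.

    The functional equation of the Euler integral is a by-product: for x > 0 the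
    same finite part is computed with and without descending from x + n, and
    finite parts are unique ([Euler_Gamma_shift]). *)

(** * Damped powers and their derivatives *)

(** The real part of e^(i d) e^(-a x), where a = r e^(i th). *)
Definition wave (r th d x : R) : R :=
  exp (- (r * cos th * x)) * cos (d - r * sin th * x).

Definition kernel (s r th d x : R) : R := Rpower x s * wave r th d x.

Lemma cos_plus_quarter (u : R) : cos (u + PI / 2) = - sin u.
Proof. rewrite cos_plus, cos_PI2, sin_PI2. ring. Qed.

Lemma exp_neg_le_1 (t : R) : 0 < t -> exp (- t) <= 1.
Proof.
  intros Ht. assert (H := exp_increasing (- t) 0 ltac:(lra)). rewrite exp_0 in H. lra.
Qed.

Lemma Rpower_pred (x s : R) : 0 < x -> Rpower x s = x * Rpower x (s - 1).
Proof.
  intros Hx. rewrite <- (Rpower_1 x) at 2 by exact Hx.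
  rewrite <- Rpower_plus. f_equal. ring.
Qed.

Lemma is_derive_Rpower (s x : R) :
  0 < x -> is_derive (fun t => Rpower t s) x (s * Rpower x (s - 1)).
Proof. intros Hx. apply is_derive_Reals. now apply derivable_pt_lim_power. Qed.

(** Differentiating e^(-a x) multiplies it by -a = -r e^(i th), which scales
    the wave and shifts its phase by [th]. *)
Lemma is_derive_wave (r th d x : R) :
  is_derive (wave r th d) x (- r * wave r th (d + th) x).
Proof.
  unfold wave. auto_derive; [easy|].
  replace (d + th - r * sin th * x) with ((d - r * sin th * x) + th) by ring.
  rewrite (cos_plus _ th).
  replace (d + - (r * sin th * x)) with (d - r * sin th * x) by ring.
  ring.
Qed.

Lemma is_derive_kernel (s r th d x : R) :
  0 < x ->
  is_derive (kernel s r th d) x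
    (s * kernel (s - 1) r th d x - r * kernel s r th (d + th) x).
Proof.
  intros Hx. unfold kernel. evar_last.
  - apply (is_derive_mult (fun t => Rpower t s) (wave r th d)).
    + now apply is_derive_Rpower.
    + apply is_derive_wave.
    + exact Rmult_comm.
  - unfold plus, mult; simpl. ring.
Qed.

(** The right-hand side is the derivative in [x] of the kernel of exponent [s]
    and phase [d + PI / 2 + s * th].  Indeed, put g(z) = z^s e^(-z) and
    z = r e^(i th) x: the derivative of g(z) / x in th and that of i g(z) in x are
    both i z g'(z) / x, and up to the factor r^s the two kernels are the real
    parts of e^(i d) g(z) / x and e^(i d) i g(z). *)
Lemma is_derive_kernel_angle (s r d x th : R) :
  0 < x ->
  is_derive (fun u => kernel (s - 1) r u (d + s * u) x) th
    (s * kernel (s - 1) r th (d + PI / 2 + s * th) x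
     - r * kernel s r th (d + PI / 2 + s * th + th) x).
Proof.
  intros Hx. unfold kernel, wave. auto_derive; [easy|].
  rewrite (Rpower_pred x s Hx).
  replace (d + PI / 2 + s * th - r * sin th * x)
    with ((d + s * th - r * sin th * x) + PI / 2) by ring.
  replace (d + PI / 2 + s * th + th - r * sin th * x)
    with (((d + s * th - r * sin th * x) + th) + PI / 2) by ring.
  rewrite !cos_plus_quarter, (sin_plus _ th).
  replace (d + s * th + - (r * sin th * x)) with (d + s * th - r * sin th * x) by ring.
  ring.
Qed.

Lemma continuous_kernel (s r th d x : R) :
  0 < x -> continuous (kernel s r th d) x.
Proof.
  intros Hx. apply (ex_derive_continuous (kernel s r th d)).
  eexists. now apply is_derive_kernel.
Qed.

Lemma between_pos (e M x : R) : 0 < e -> 0 < M -> Rmin e M <= x -> 0 < x.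
Proof. intros He HM Hx. assert (H := Rmin_glb_lt e M 0 He HM). lra. Qed.

Lemma is_RInt_kernel_derive (s r th d e M : R) :
  0 < e -> 0 < M ->
  is_RInt (fun x => s * kernel (s - 1) r th d x - r * kernel s r th (d + th) x)
    e M (kernel s r th d M - kernel s r th d e).
Proof.
  intros He HM.
  apply (is_RInt_derive (kernel s r th d)).
  - intros x Hx. apply is_derive_kernel. apply (between_pos e M); tauto.
  - intros x Hx. assert (0 < x) by (apply (between_pos e M); tauto).
    apply (continuous_minus (U := R_UniformSpace) (V := R_NormedModule)).
    + apply (continuous_scal_r s (kernel (s - 1) r th d)). now apply continuous_kernel.
    + apply (continuous_scal_r r (kernel s r th (d + th))). now apply continuous_kernel.
Qed.

Lemma ex_RInt_kernel (s r th d e M : R) :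
  0 < e -> 0 < M -> ex_RInt (kernel s r th d) e M.
Proof.
  intros He HM. apply (ex_RInt_continuous (kernel s r th d)).
  intros x Hx. apply continuous_kernel. apply (between_pos e M); tauto.
Qed.

Lemma Rabs_wave_le (r th d x : R) :
  Rabs (wave r th d x) <= exp (- (r * cos th * x)).
Proof.
  unfold wave. rewrite Rabs_mult.
  assert (H := exp_pos (- (r * cos th * x))).
  rewrite (Rabs_pos_eq (exp _)) by lra.
  assert (Hc : Rabs (cos (d - r * sin th * x)) <= 1)
    by (apply Rabs_le, COS_bound).
  nra.
Qed.

Lemma Rabs_kernel_le (s r th d x : R) :
  Rabs (kernel s r th d x) <= Rpower x s * exp (- (r * cos th * x)).
Proof.
  unfold kernel. rewrite Rabs_mult.
  assert (H : 0 < Rpower x s) by apply exp_pos.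
  rewrite (Rabs_pos_eq (Rpower x s)) by lra.
  apply Rmult_le_compat_l; [lra|apply Rabs_wave_le].
Qed.

(** From ln u <= u at u = c x / s; the bound is x^s at the point x = s / c. *)
Lemma Rpower_exp_le (s c x : R) :
  0 < s -> 0 < c -> 0 < x -> Rpower x s * exp (- (c * x)) <= Rpower (s / c) s.
Proof.
  intros Hs Hc Hx. unfold Rpower. rewrite <- exp_plus.
  assert (Hu : 0 < c * x / s).
  { apply Rdiv_lt_0_compat; [now apply Rmult_lt_0_compat|exact Hs]. }
  assert (Hln : ln x = ln (c * x / s) + ln (s / c)).
  { rewrite <- ln_mult; [|exact Hu|now apply Rdiv_lt_0_compat].
    f_equal. field. lra. }
  assert (Hle : ln (c * x / s) < c * x / s).
  { rewrite <- (ln_exp (c * x / s)) at 2. apply ln_increasing; [exact Hu|].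
    assert (H := exp_ineq1 (c * x / s)). lra. }
  assert (s * ln (c * x / s) < c * x).
  { apply (Rmult_lt_compat_l s) in Hle; [|exact Hs].
    replace (s * (c * x / s)) with (c * x) in Hle by (field; lra). exact Hle. }
  apply Rlt_le, exp_increasing. rewrite Hln. lra.
Qed.

Lemma Rpower_exp_lim_infty (s c : R) :
  0 < c ->
  filterlim (fun x => Rpower x s * exp (- (c * x))) (Rbar_locally p_infty) (locally 0).
Proof.
  intros Hc.
  set (t := Rmax s 1 + 1).
  assert (Ht : 0 < t) by (unfold t; generalize (Rmax_r s 1); lra).
  assert (Hst : s + 1 <= t) by (unfold t; generalize (Rmax_l s 1); lra).
  set (K := Rpower (t / c) t).
  assert (HK : 0 < K) by apply exp_pos.
  apply filterlim_locally. intros eps.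
  (* [x * (x^s e^(-cx))] is at most [x^t e^(-cx) <= K] for [x > 1]. *)
  exists (Rmax 1 (K / eps)). intros x Hx.
  assert (Hx1 : 1 < x) by (eapply Rle_lt_trans; [apply Rmax_l|exact Hx]).
  assert (Hx2 : K / eps < x) by (eapply Rle_lt_trans; [apply Rmax_r|exact Hx]).
  change (Rabs (Rpower x s * exp (- (c * x)) - 0) < eps).
  assert (Hpos : 0 < Rpower x s * exp (- (c * x)))
    by (apply Rmult_lt_0_compat; apply exp_pos).
  rewrite Rminus_0_r, Rabs_pos_eq by lra.
  assert (Heps := cond_pos eps).
  apply (Rmult_lt_reg_l x); [lra|].
  apply (Rle_lt_trans _ K).
  - apply (Rle_trans _ (Rpower x t * exp (- (c * x)))).
    + rewrite <- Rmult_assoc. apply Rmult_le_compat_r; [apply Rlt_le, exp_pos|].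
      rewrite <- (Rpower_1 x) at 1 by lra. rewrite <- Rpower_plus.
      apply Rle_Rpower; lra.
    + apply Rpower_exp_le; lra.
  - apply (Rmult_lt_compat_r eps) in Hx2; [|exact Heps].
    replace (K / eps * eps) with K in Hx2 by (field; lra). lra.
Qed.

Lemma Rpower_lim_0 (s : R) :
  0 < s -> filterlim (fun x => Rpower x s) (at_right 0) (locally 0).
Proof.
  intros Hs. apply filterlim_locally. intros eps.
  assert (Heps := cond_pos eps).
  exists (mkposreal _ (exp_pos (ln eps / s))). intros x Hx Hpos.
  change (Rabs (x - 0) < exp (ln eps / s)) in Hx.
  rewrite Rminus_0_r, Rabs_pos_eq in Hx by lra.
  change (Rabs (Rpower x s - 0) < eps).
  assert (H : 0 < Rpower x s) by apply exp_pos.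
  rewrite Rminus_0_r, Rabs_pos_eq by lra.
  unfold Rpower. rewrite <- (exp_ln eps) by exact Heps.
  apply exp_increasing. apply ln_increasing in Hx; [|exact Hpos].
  rewrite ln_exp in Hx. apply (Rmult_lt_compat_l s) in Hx; [|exact Hs].
  replace (s * (ln eps / s)) with (ln eps) in Hx by (field; lra). exact Hx.
Qed.

(** * The Gamma integral along a ray *)

Notation ends := (filter_prod (at_right 0) (Rbar_locally p_infty)).

Lemma ends_ordered : ends (fun b => 0 < fst b < 1 /\ 1 < snd b).
Proof.
  apply (Filter_prod _ _ _ (fun e => 0 < e < 1) (fun M => 1 < M)).
  - exists (mkposreal 1 Rlt_0_1). intros e He Hpos.
    change (Rabs (e - 0) < 1) in He. apply Rabs_def2 in He. lra.
  - exists 1. tauto.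
  - simpl. tauto.
Qed.

Lemma is_RInt_gen_of_RInt_lim (g : R -> R) (L : R) :
  (forall e M, 0 < e -> 0 < M -> ex_RInt g e M) ->
  filterlim (fun b => RInt g (fst b) (snd b)) ends (locally L) ->
  is_RInt_gen g (at_right 0) (Rbar_locally p_infty) L.
Proof.
  intros Hg HL P HP. assert (HLP := HL P HP). unfold filtermap in HLP.
  generalize (filter_and _ _ ends_ordered HLP). unfold filtermapi.
  apply filter_imp. intros [e M] [[He HM] H].
  exists (RInt g e M). split; [|exact H].
  apply (RInt_correct g), Hg; simpl in *; lra.
Qed.

(** The integral over [[e, M]] grows as [e] decreases and [M] increases, so it
    converges to its least upper bound. *)
Lemma RInt_lim_of_bounded (g : R -> R) (B : R) :
  (forall x, 0 < x -> 0 < g x) ->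
  (forall x, 0 < x -> continuous g x) ->
  (forall e M, 0 < e -> e <= M -> RInt g e M <= B) ->
  exists L, 0 < L /\
    filterlim (fun b => RInt g (fst b) (snd b)) ends (locally L).
Proof.
  intros Hpos Hcont HB.
  assert (Hex : forall e M, 0 < e -> 0 < M -> ex_RInt g e M).
  { intros e M He HM. apply (ex_RInt_continuous g). intros x Hx.
    apply Hcont, (between_pos e M); tauto. }
  assert (Hge : forall e M, 0 < e -> e <= M -> 0 <= RInt g e M).
  { intros e M He HM. apply RInt_ge_0; [exact HM|apply Hex; lra|].
    intros x Hx. apply Rlt_le, Hpos. lra. }
  destruct (completeness (fun I => exists e M, 0 < e /\ e <= M /\ I = RInt g e M))
    as [L [Hub Hlub]].
  { exists B. intros I (e & M & He & HM & ->). now apply HB. }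
  { exists (RInt g 1 2), 1, 2. repeat split; lra. }
  exists L. split.
  - apply (Rlt_le_trans _ (RInt g 1 2)).
    + apply RInt_gt_0; [lra| |]; intros x Hx; [apply Hpos|apply Hcont]; lra.
    + apply Hub. exists 1, 2. repeat split; lra.
  - apply filterlim_locally. intros eps. assert (Heps := cond_pos eps).
    assert (Hnear : exists e M, 0 < e /\ e <= M /\ L - eps < RInt g e M).
    { apply Classical_Prop.NNPP. intros Hno.
      assert (HL : L <= L - eps).
      { apply Hlub. intros I (e & M & He & HM & ->).
        apply Rnot_lt_le. intros Hlt. apply Hno. now exists e, M. }
      lra. }
    destruct Hnear as (e0 & M0 & He0 & HM0 & Hlow).
    apply (Filter_prod _ _ _ (fun e => 0 < e < e0) (fun M => M0 < M)).
    + exists (mkposreal _ He0). intros e He Hp.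
      change (Rabs (e - 0) < e0) in He. apply Rabs_def2 in He. lra.
    + exists M0. tauto.
    + intros e M He HM. change (Rabs (RInt g e M - L) < eps).
      assert (Hup : RInt g e M <= L).
      { apply Hub. exists e, M. repeat split; lra. }
      assert (Hsplit : RInt g e M = RInt g e e0 + RInt g e0 M0 + RInt g M0 M).
      { rewrite <- (RInt_Chasles g e e0 M), <- (RInt_Chasles g e0 M0 M);
          try (apply Hex; lra). unfold plus; simpl. ring. }
      assert (H1 := Hge e e0). assert (H2 := Hge M0 M).
      apply Rabs_def1; lra.
Qed.

Lemma kernel_gamma (s x : R) : kernel s 1 0 0 x = exp (- x) * Rpower x s.
Proof.
  unfold kernel, wave. rewrite sin_0, cos_0.
  replace (0 - 1 * 0 * x) with 0 by ring. rewrite cos_0.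
  replace (1 * 1 * x) with x by ring. ring.
Qed.

(** By parts, the integral with exponent [s - 1], singular at 0 when s < 1,
    reduces to the one with exponent [s], whose integrand is at most a
    constant times e^(-x/2). *)
Lemma Gamma_integral_bounded (s : R) :
  0 < s -> exists B, forall e M, 0 < e -> e <= M ->
    RInt (kernel (s - 1) 1 0 0) e M <= B.
Proof.
  intros Hs.
  (* [K] bounds [x^s e^(-x/2)]; the other half of the exponential is integrated. *)
  set (K := Rpower (s / (1 / 2)) s).
  assert (HK : 0 < K) by apply exp_pos.
  assert (Hk : forall x, 0 < x -> 0 < kernel s 1 0 0 x <= K * exp (- (1 / 2 * x))).
  { intros x Hx. rewrite kernel_gamma. split.
    - apply Rmult_lt_0_compat; apply exp_pos.
    - replace (exp (- x)) with (exp (- (1 / 2 * x)) * exp (- (1 / 2 * x)))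
        by (rewrite <- exp_plus; f_equal; field).
      rewrite Rmult_assoc, Rmult_comm. apply Rmult_le_compat_r; [apply Rlt_le, exp_pos|].
      rewrite Rmult_comm. apply Rpower_exp_le; lra. }
  assert (Hk1 : forall x, 0 < x -> exp (- (1 / 2 * x)) <= 1)
    by (intros x Hx; apply exp_neg_le_1; lra).
  exists ((K + 2 * K) / s). intros e M He HM.
  assert (Hparts : s * RInt (kernel (s - 1) 1 0 0) e M - 1 * RInt (kernel s 1 0 0) e M
                   = kernel s 1 0 0 M - kernel s 1 0 0 e).
  { assert (H := is_RInt_kernel_derive s 1 0 0 e M He ltac:(lra)).
    rewrite Rplus_0_l in H.
    apply (is_RInt_unique (V := R_CompleteNormedModule)) in H. rewrite <- H. symmetry.
    transitivity (RInt (fun x => minus (scal s (kernel (s - 1) 1 0 0 x))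
                                  (scal 1 (kernel s 1 0 0 x))) e M); [reflexivity|].
    rewrite (RInt_minus (V := R_CompleteNormedModule));
      try (apply (ex_RInt_scal (V := R_NormedModule)), ex_RInt_kernel; lra).
    rewrite !(RInt_scal (V := R_CompleteNormedModule)); try (apply ex_RInt_kernel; lra).
    reflexivity. }
  assert (Hint : RInt (kernel s 1 0 0) e M <= 2 * K).
  { assert (Hd : is_RInt (fun x => K * exp (- (1 / 2 * x))) e M
       (- 2 * K * exp (- (1 / 2 * M)) - - 2 * K * exp (- (1 / 2 * e)))).
    { apply (is_RInt_derive (fun x => - 2 * K * exp (- (1 / 2 * x)))).
      - intros x _. auto_derive; [easy|]. field.
      - intros x _. apply (ex_derive_continuous (fun x => K * exp (- (1 / 2 * x)))).
        auto_derive. easy. }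
    apply (Rle_trans _ (RInt (fun x => K * exp (- (1 / 2 * x))) e M)).
    - apply RInt_le; [exact HM|apply ex_RInt_kernel; lra|eexists; exact Hd|].
      intros x Hx. apply Hk. lra.
    - rewrite (is_RInt_unique _ _ _ _ Hd).
      assert (H1 := Hk1 e He). assert (H2 := exp_pos (- (1 / 2 * M))). nra. }
  assert (HM' := Hk M ltac:(lra)). assert (He' := Hk e He).
  assert (HM1 := Hk1 M ltac:(lra)).
  apply (Rmult_le_reg_l s); [exact Hs|].
  replace (s * ((K + 2 * K) / s)) with (K + 2 * K) by (field; lra). nra.
Qed.

Lemma Euler_Gamma_lim (s : R) :
  0 < s -> 0 < Euler_Gamma s /\
  filterlim (fun b => RInt (kernel (s - 1) 1 0 0) (fst b) (snd b)) ends
    (locally (Euler_Gamma s)).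
Proof.
  intros Hs. destruct (Gamma_integral_bounded s Hs) as [B HB].
  destruct (RInt_lim_of_bounded (kernel (s - 1) 1 0 0) B) as [L [HL Hlim]]; trivial.
  - intros x Hx. rewrite kernel_gamma. apply Rmult_lt_0_compat; apply exp_pos.
  - intros x Hx. now apply continuous_kernel.
  - assert (H : Euler_Gamma s = L).
    { unfold Euler_Gamma. apply (is_RInt_gen_unique (V := R_CompleteNormedModule)).
      apply (is_RInt_gen_ext (kernel (s - 1) 1 0 0)).
      - apply filter_forall. intros b x _. apply kernel_gamma.
      - apply is_RInt_gen_of_RInt_lim; [|exact Hlim].
        intros e M He HM. now apply ex_RInt_kernel. }
    rewrite H. now split.
Qed.

Lemma RInt_kernel_scale (s r e M : R) :
  0 < r -> 0 < e -> 0 < M ->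
  RInt (kernel (s - 1) r 0 0) e M
  = Rpower r (- s) * RInt (kernel (s - 1) 1 0 0) (r * e) (r * M).
Proof.
  intros Hr He HM.
  apply is_RInt_unique.
  assert (Hex : ex_RInt (kernel (s - 1) 1 0 0) (r * e + 0) (r * M + 0)).
  { rewrite !Rplus_0_r. apply ex_RInt_kernel; now apply Rmult_lt_0_compat. }
  assert (H := is_RInt_comp_lin _ r 0 e M _ (RInt_correct _ _ _ Hex)).
  rewrite !Rplus_0_r in H.
  apply (is_RInt_scal _ _ _ (Rpower r (- s))) in H.
  eapply is_RInt_ext; [|exact H].
  intros x Hx. unfold scal; simpl; unfold mult; simpl.
  assert (Hx0 : 0 < x) by (apply (between_pos e M); tauto || lra).
  rewrite Rplus_0_r. unfold kernel, wave. rewrite sin_0, !Rmult_0_r, !Rmult_0_l.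
  rewrite <- Rpower_mult_distr by assumption.
  set (w := exp (- (1 * cos 0 * (r * x))) * cos (0 - 0)).
  replace (Rpower r (- s) * (r * (Rpower r (s - 1) * Rpower x (s - 1) * w)))
    with ((Rpower r (- s) * (r * Rpower r (s - 1))) * (Rpower x (s - 1) * w)) by ring.
  rewrite <- Rpower_pred by exact Hr. rewrite <- Rpower_plus.
  replace (- s + s) with 0 by ring. rewrite Rpower_O by exact Hr.
  rewrite Rmult_1_l. unfold w. do 4 f_equal. ring.
Qed.

Lemma ends_scale (r : R) :
  0 < r -> filterlim (fun b : R * R => (r * fst b, r * snd b)) ends ends.
Proof.
  intros Hr. apply filterlim_pair.
  - apply (filterlim_comp _ _ _ fst (fun e => r * e) _ (at_right 0));
      [apply filterlim_fst|].
    intros P [d Hd].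
    assert (Hdr : 0 < d / r) by (apply Rdiv_lt_0_compat; [apply cond_pos|exact Hr]).
    exists (mkposreal _ Hdr). intros e He Hpos.
    change (Rabs (e - 0) < d / r) in He.
    rewrite Rminus_0_r, Rabs_pos_eq in He by lra.
    apply Hd; [|now apply Rmult_lt_0_compat].
    change (Rabs (r * e - 0) < d).
    rewrite Rminus_0_r, Rabs_pos_eq by (apply Rmult_le_pos; lra).
    apply (Rmult_lt_compat_l r) in He; [|exact Hr].
    replace (r * (d / r)) with (pos d) in He by (field; lra). exact He.
  - apply (filterlim_comp _ _ _ snd (fun e => r * e) _ (Rbar_locally p_infty));
      [apply filterlim_snd|].
    intros P [d Hd]. exists (d / r). intros M HM. apply Hd.
    apply (Rmult_lt_compat_l r) in HM; [|exact Hr].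
    replace (r * (d / r)) with d in HM by (field; lra). exact HM.
Qed.

Lemma continuity_2d_pt_kernel (s r : R) (phase : R -> R) (th x : R) :
  0 < x -> continuity_pt phase th ->
  continuity_2d_pt (fun u v => kernel s r u (phase u) v) th x.
Proof.
  intros Hx Hphase. unfold kernel, wave.
  assert (Hu : continuity_2d_pt (fun u _ : R => u) th x) by apply continuity_2d_pt_id1.
  assert (Hv : continuity_2d_pt (fun _ v : R => v) th x) by apply continuity_2d_pt_id2.
  assert (Hr : continuity_2d_pt (fun _ _ : R => r) th x) by apply continuity_2d_pt_const.
  apply continuity_2d_pt_mult; [|apply continuity_2d_pt_mult].
  - apply (continuity_1d_2d_pt_comp (fun t => Rpower t s) (fun _ v => v)); [|exact Hv].
    apply derivable_continuous_pt. exists (s * Rpower x (s - 1)).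
    now apply derivable_pt_lim_power.
  - apply (continuity_1d_2d_pt_comp exp).
    + apply derivable_continuous_pt, derivable_pt_exp.
    + apply continuity_2d_pt_opp, continuity_2d_pt_mult; [|exact Hv].
      apply continuity_2d_pt_mult; [exact Hr|].
      apply (continuity_1d_2d_pt_comp cos); [apply continuity_cos|exact Hu].
  - apply (continuity_1d_2d_pt_comp cos); [apply continuity_cos|].
    apply continuity_2d_pt_minus.
    + now apply (continuity_1d_2d_pt_comp phase).
    + apply continuity_2d_pt_mult; [|exact Hv].
      apply continuity_2d_pt_mult; [exact Hr|].
      apply (continuity_1d_2d_pt_comp sin); [apply continuity_sin|exact Hu].
Qed.

Lemma is_derive_RInt_kernel_angle (s r d e M th : R) :
  0 < e -> 0 < M ->
  is_derive (fun u => RInt (kernel (s - 1) r u (d + s * u)) e M) th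
    (kernel s r th (d + PI / 2 + s * th) M - kernel s r th (d + PI / 2 + s * th) e).
Proof.
  intros He HM.
  assert (HD : forall u x, 0 < x ->
     Derive (fun z => kernel (s - 1) r z (d + s * z) x) u
     = s * kernel (s - 1) r u (d + PI / 2 + s * u) x
       - r * kernel s r u (d + PI / 2 + s * u + u) x).
  { intros u x Hx. apply is_derive_unique. now apply is_derive_kernel_angle. }
  assert (Hpos : forall x, Rmin e M <= x <= Rmax e M -> 0 < x)
    by (intros x Hx; apply (between_pos e M); tauto).
  evar_last.
  - apply (is_derive_RInt_param (fun u x => kernel (s - 1) r u (d + s * u) x) e M th).
    + apply filter_forall. intros u x Hx. eexists.
      apply is_derive_kernel_angle. now apply Hpos.
    + intros x Hx. apply Hpos in Hx.
      eapply continuity_2d_pt_ext_loc.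
      * exists (mkposreal x Hx). intros u v _ Hv. simpl in Hv.
        symmetry. apply HD. apply Rabs_def2 in Hv. lra.
      * apply continuity_2d_pt_minus; apply continuity_2d_pt_mult;
          try apply continuity_2d_pt_const; apply continuity_2d_pt_kernel; trivial; reg.
    + apply filter_forall. intros u. now apply ex_RInt_kernel.
  - simpl.
    rewrite <- (is_RInt_unique _ _ _ _
      (is_RInt_kernel_derive s r th (d + PI / 2 + s * th) e M He HM)).
    apply RInt_ext. intros x Hx. apply HD. apply Hpos. lra.
Qed.

Lemma cos_angle_le (u th : R) :
  Rabs th < PI / 2 -> Rabs u <= Rabs th -> cos th <= cos u.
Proof.
  intros Hth Hu.
  assert (Habs : forall z, cos (Rabs z) = cos z).
  { intros z. unfold Rabs. destruct (Rcase_abs z); [apply cos_neg|reflexivity]. }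
  rewrite <- (Habs th), <- (Habs u).
  assert (H0 := Rabs_pos u). assert (H1 := Rabs_pos th). assert (HPI := PI_RGT_0).
  apply cos_decr_1; lra.
Qed.

(** The derivative in the angle is a difference of boundary values; the mean
    value theorem bounds the effect of a rotation by their size.  At [M] this
    size is greatest at the extreme angle, because cos decreases away from 0. *)
Lemma RInt_kernel_rotate (s r d e M th : R) :
  0 < r -> 0 < e -> 0 < M -> Rabs th < PI / 2 ->
  Rabs (RInt (kernel (s - 1) r th (d + s * th)) e M - RInt (kernel (s - 1) r 0 d) e M)
  <= (Rpower M s * exp (- (r * cos th * M)) + Rpower e s) * Rabs th.
Proof.
  intros Hr He HM Hth.
  destruct (MVT_gen (fun u => RInt (kernel (s - 1) r u (d + s * u)) e M) 0 th
    (fun u => kernel s r u (d + PI / 2 + s * u) M - kernel s r u (d + PI / 2 + s * u) e))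
    as [u [Hu Heq]].
  - intros u _. now apply is_derive_RInt_kernel_angle.
  - intros u _. apply continuity_pt_filterlim.
    apply (ex_derive_continuous (fun u => RInt (kernel (s - 1) r u (d + s * u)) e M)).
    eexists. now apply is_derive_RInt_kernel_angle.
  - rewrite Rmult_0_r, Rplus_0_r, Rminus_0_r in Heq. rewrite Heq, Rabs_mult.
    apply Rmult_le_compat_r; [apply Rabs_pos|].
    assert (Hcos : cos th <= cos u).
    { apply cos_angle_le; [exact Hth|]. revert Hu. unfold Rmin, Rmax.
      destruct (Rle_dec 0 th); intros Hu; unfold Rabs;
        destruct (Rcase_abs u), (Rcase_abs th); lra. }
    assert (Hcos0 : 0 < cos th).
    { apply Rabs_def2 in Hth. apply cos_gt_0; lra. }
    eapply Rle_trans; [apply Rabs_triang|]. rewrite Rabs_Ropp.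
    apply Rplus_le_compat; (eapply Rle_trans; [apply Rabs_kernel_le|]).
    + apply Rmult_le_compat_l; [apply Rlt_le, exp_pos|].
      assert (r * cos th * M <= r * cos u * M) by
        (apply Rmult_le_compat_r; [lra|]; apply Rmult_le_compat_l; lra).
      destruct (Req_dec (r * cos th * M) (r * cos u * M)) as [->|]; [lra|].
      apply Rlt_le, exp_increasing. lra.
    + rewrite <- (Rmult_1_r (Rpower e s)) at 2.
      apply Rmult_le_compat_l; [apply Rlt_le, exp_pos|].
      apply exp_neg_le_1.
      apply Rmult_lt_0_compat; [apply Rmult_lt_0_compat; lra|exact He].
Qed.

(** On the ray of angle [th] the phase that makes the rotation exact is
    [d = d0 + s * th]; the phase [d0] left at angle 0 is a constant factor. *)
Lemma RInt_kernel_lim (s r th d : R) :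
  0 < s -> 0 < r -> Rabs th < PI / 2 ->
  filterlim (fun b => RInt (kernel (s - 1) r th d) (fst b) (snd b)) ends
    (locally (Euler_Gamma s * Rpower r (- s) * cos (d - s * th))).
Proof.
  intros Hs Hr Hth.
  set (d0 := d - s * th).
  assert (Hcos0 : 0 < cos th).
  { destruct (Rabs_def2 _ _ Hth). apply cos_gt_0; lra. }
  assert (Hray : filterlim
    (fun b => cos d0 * (Rpower r (- s) * RInt (kernel (s - 1) 1 0 0) (r * fst b) (r * snd b)))
    ends (locally (cos d0 * (Rpower r (- s) * Euler_Gamma s)))).
  { apply (filterlim_comp _ _ _
      (fun b => RInt (kernel (s - 1) 1 0 0) (r * fst b) (r * snd b))
      (fun I => cos d0 * (Rpower r (- s) * I)) _ (locally (Euler_Gamma s))).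
    - apply (filterlim_comp _ _ _ (fun b => (r * fst b, r * snd b))
        (fun b => RInt (kernel (s - 1) 1 0 0) (fst b) (snd b)) _ ends).
      + now apply ends_scale.
      + now apply Euler_Gamma_lim.
    - apply (ex_derive_continuous (fun I => cos d0 * (Rpower r (- s) * I))).
      auto_derive. easy. }
  assert (Herr : filterlim
    (fun b => (Rpower (snd b) s * exp (- (r * cos th * snd b)) + Rpower (fst b) s) * Rabs th)
    ends (locally ((0 + 0) * Rabs th))).
  { apply (filterlim_comp _ _ _
      (fun b => Rpower (snd b) s * exp (- (r * cos th * snd b)) + Rpower (fst b) s)
      (fun I => I * Rabs th) _ (locally (0 + 0))).
    - apply (filterlim_comp_2 (G := locally 0) (H := locally 0)
        (fun b : R * R => Rpower (snd b) s * exp (- (r * cos th * snd b)))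
        (fun b : R * R => Rpower (fst b) s) Rplus).
      + apply (filterlim_comp _ _ _ snd (fun M => Rpower M s * exp (- (r * cos th * M)))
          _ (Rbar_locally p_infty));
          [apply filterlim_snd|].
        apply Rpower_exp_lim_infty. now apply Rmult_lt_0_compat.
      + apply (filterlim_comp _ _ _ fst (fun e => Rpower e s) _ (at_right 0));
          [apply filterlim_fst|]. now apply Rpower_lim_0.
      + apply (filterlim_plus (V := R_NormedModule)).
    - apply (ex_derive_continuous (fun I => I * Rabs th)). auto_derive. easy. }
  apply filterlim_locally. intros eps.
  assert (Heps := cond_pos eps).
  assert (Hhalf : 0 < eps / 2) by lra.
  assert (H1 := proj1 (filterlim_locally _ _) Hray (mkposreal _ Hhalf)).
  assert (H2 := proj1 (filterlim_locally _ _) Herr (mkposreal _ Hhalf)).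
  generalize (filter_and _ _ ends_ordered (filter_and _ _ H1 H2)).
  apply filter_imp. intros [e M]. simpl. intros [[He HM] [Hb1 Hb2]].
  change (Rabs (cos d0 * (Rpower r (- s) * RInt (kernel (s - 1) 1 0 0) (r * e) (r * M))
     - cos d0 * (Rpower r (- s) * Euler_Gamma s)) < eps / 2) in Hb1.
  change (Rabs ((Rpower M s * exp (- (r * cos th * M)) + Rpower e s) * Rabs th
     - (0 + 0) * Rabs th) < eps / 2) in Hb2.
  change (Rabs (RInt (kernel (s - 1) r th d) e M
     - Euler_Gamma s * Rpower r (- s) * cos d0) < eps).
  assert (Hrot := RInt_kernel_rotate s r d0 e M th Hr ltac:(lra) ltac:(lra) Hth).
  replace (d0 + s * th) with d in Hrot by (unfold d0; ring).
  assert (H0 : RInt (kernel (s - 1) r 0 d0) e M = cos d0 * RInt (kernel (s - 1) r 0 0) e M).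
  { rewrite <- (RInt_scal (V := R_CompleteNormedModule)) by (apply ex_RInt_kernel; lra).
    apply RInt_ext. intros x _. unfold scal; simpl; unfold mult; simpl.
    unfold kernel, wave. rewrite sin_0, !Rmult_0_r, !Rmult_0_l, !Rminus_0_r, cos_0.
    ring. }
  rewrite H0, RInt_kernel_scale in Hrot by lra.
  rewrite <- Rabs_Ropp in Hb1.
  apply Rabs_def2 in Hb1. apply Rabs_def2 in Hb2.
  apply Rabs_le_between in Hrot. apply Rabs_def1; lra.
Qed.

(** * Hadamard finite parts *)

(** Convergence to 0 in modulus, which allows multiplication by complex
    constants, whereas the normed module of the definition of the transform has
    real scalars. *)
Definition vanishes {T : Type} (F : (T -> Prop) -> Prop) (h : T -> C) : Prop :=
  forall eps : posreal, F (fun x => Cmod (h x) < eps).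

Section Vanishes.
Context {T : Type} {F : (T -> Prop) -> Prop} {FF : Filter F}.

Lemma filterlim_C_of_vanishes (h : T -> C) (L : C) :
  vanishes F (fun x => h x - L)%C ->
  filterlim h F (locally (T := C_R_NormedModule) L).
Proof.
  intros H. apply (filterlim_locally_ball_norm (U := C_R_NormedModule)).
  intros eps. generalize (H eps). apply filter_imp. intros x Hx.
  rewrite Cmod_norm in Hx. exact Hx.
Qed.

Lemma vanishes_plus (g h : T -> C) :
  vanishes F g -> vanishes F h -> vanishes F (fun x => g x + h x)%C.
Proof.
  intros Hg Hh eps. set (e2 := pos_div_2 eps).
  generalize (filter_and _ _ (Hg e2) (Hh e2)). apply filter_imp.
  intros x [H1 H2]. assert (H := Cmod_triangle (g x) (h x)).
  simpl in *. lra.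
Qed.

Lemma vanishes_scal (c : C) (g : T -> C) :
  vanishes F g -> vanishes F (fun x => c * g x)%C.
Proof.
  intros Hg eps. assert (Hc := Cmod_ge_0 c).
  assert (Hd : 0 < eps / (Cmod c + 1))
    by (apply Rdiv_lt_0_compat; [apply cond_pos|lra]).
  generalize (Hg (mkposreal _ Hd)). apply filter_imp. intros x Hx. simpl in Hx.
  rewrite Cmod_mult. assert (H0 := Cmod_ge_0 (g x)).
  apply (Rmult_lt_compat_r (Cmod c + 1)) in Hx; [|lra].
  replace (eps / (Cmod c + 1) * (Cmod c + 1)) with (pos eps) in Hx by (field; lra).
  nra.
Qed.

Lemma vanishes_le (g : T -> R) (h : T -> C) :
  F (fun x => Cmod (h x) <= g x) -> filterlim g F (locally 0) -> vanishes F h.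
Proof.
  intros Hle Hg eps.
  generalize (filter_and _ _ Hle (proj1 (filterlim_locally _ _) Hg eps)).
  apply filter_imp. intros x [H1 H2]. change (Rabs (g x - 0) < eps) in H2.
  rewrite Rminus_0_r in H2. assert (H := Rle_abs (g x)). lra.
Qed.

Lemma vanishes_RtoC (g : T -> R) (l : R) :
  filterlim g F (locally l) -> vanishes F (fun x => RtoC (g x) - RtoC l)%C.
Proof.
  intros Hg eps. generalize (proj1 (filterlim_locally _ _) Hg eps).
  apply filter_imp. intros x Hx. rewrite <- RtoC_minus, Cmod_R. exact Hx.
Qed.

Lemma vanishes_ext (g h : T -> C) :
  F (fun x => g x = h x) -> vanishes F g -> vanishes F h.
Proof.
  intros Hext Hg eps. generalize (filter_and _ _ Hext (Hg eps)).
  apply filter_imp. intros x [-> H]. exact H.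
Qed.

End Vanishes.

Lemma at_right_pos : at_right 0 (fun e => 0 < e).
Proof. exists (mkposreal 1 Rlt_0_1). tauto. Qed.

(** The functions that a finite part can discard as boundary terms at 0. *)
Definition has_polar_part (h : R -> C) : Prop :=
  exists cs : list (C * R), (forall t, In t cs -> 0 < snd t) /\
    vanishes (at_right 0) (fun e => h e - power_sum cs e)%C.

Lemma has_polar_part_plus (g h : R -> C) :
  has_polar_part g -> has_polar_part h -> has_polar_part (fun e => g e + h e)%C.
Proof.
  intros (cs & Hcs & Hg) (ds & Hds & Hh). exists (cs ++ ds). split.
  - intros t Ht. apply in_app_or in Ht. destruct Ht; auto.
  - apply (vanishes_ext (fun e => (g e - power_sum cs e) + (h e - power_sum ds e))%C).
    + apply filter_forall. intros e. rewrite power_sum_app. ring.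
    + now apply vanishes_plus.
Qed.

Lemma has_polar_part_of_vanishes (h : R -> C) :
  vanishes (at_right 0) h -> has_polar_part h.
Proof.
  intros Hh. exists nil. split; [intros t []|].
  apply (vanishes_ext h); [|exact Hh].
  apply filter_forall. intros e. simpl. ring.
Qed.

Lemma has_polar_part_power (c s : R) :
  s <> 0 -> has_polar_part (fun e => RtoC (c * Rpower e s)).
Proof.
  intros Hs. destruct (Rlt_le_dec s 0) as [Hneg|Hpos].
  - exists ((RtoC c, - s) :: nil)%list. split.
    + intros t [<-|[]]. simpl. lra.
    + apply (vanishes_ext (fun _ => RtoC 0)).
      * apply filter_forall. intros e. simpl.
        rewrite Ropp_involutive, RtoC_mult. ring.
      * intros eps. apply filter_forall. intros e. rewrite Cmod_0. apply cond_pos.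
  - apply has_polar_part_of_vanishes.
    apply (vanishes_ext (fun e => RtoC c * (RtoC (Rpower e s) - RtoC 0))%C).
    + apply filter_forall. intros e. rewrite RtoC_mult. ring.
    + apply vanishes_scal, vanishes_RtoC, Rpower_lim_0. lra.
Qed.

(** An exponent [s + m] equal to 0 would leave a constant, which is neither
    divergent nor negligible; this is where the poles of Gamma are excluded. *)
Lemma has_polar_part_sum (a : nat -> R) (s : R) (n : nat) :
  ~ Gamma_pole s ->
  has_polar_part (fun e => RtoC (sum_f_R0 (fun m => a m * Rpower e (s + INR m)) n)).
Proof.
  intros Hs.
  assert (Hterm : forall m, has_polar_part (fun e => RtoC (a m * Rpower e (s + INR m)))).
  { intros m. apply has_polar_part_power. intros H0. apply Hs. exists m. lra. }
  induction n as [|n IH]; [apply Hterm|].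
  destruct (has_polar_part_plus _ _ IH (Hterm (S n))) as (cs & Hcs & Hlim).
  exists cs. split; [exact Hcs|].
  eapply vanishes_ext; [|exact Hlim].
  apply filter_forall. intros e. cbv beta. rewrite <- RtoC_plus. reflexivity.
Qed.

Lemma pos_after_shift (x : R) : 0 < x + INR (Z.to_nat (up (- x))).
Proof.
  destruct (archimed (- x)) as [Hup _].
  assert (H : IZR (up (- x)) <= INR (Z.to_nat (up (- x)))).
  { rewrite INR_IZR_INZ. apply IZR_le. lia. }
  lra.
Qed.

Lemma Derive_n_wave (r th : R) (n : nat) : forall d x,
  is_derive_n (wave r th d) n x ((- r) ^ n * wave r th (d + INR n * th) x).
Proof.
  induction n as [|n IH]; intros d x.
  - simpl. rewrite Rmult_0_l, Rplus_0_r. ring.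
  - apply (is_derive_ext (fun t => (- r) ^ n * wave r th (d + INR n * th) t)).
    + intros t. symmetry. apply is_derive_n_unique, IH.
    + evar_last.
      * apply (is_derive_scal (wave r th (d + INR n * th)) x ((- r) ^ n)), is_derive_wave.
      * rewrite S_INR. replace (d + (INR n + 1) * th) with (d + INR n * th + th) by ring.
        simpl. ring.
Qed.

(** Taylor's formula for the wave at 0, to an order [n] such that the remainder,
    of size e^(s+n+1), vanishes. *)
Lemma has_polar_part_kernel (s r th d : R) :
  ~ Gamma_pole s -> 0 < r -> 0 < cos th ->
  has_polar_part (fun e => RtoC (kernel s r th d e)).
Proof.
  intros Hs Hr Hcos.
  assert (Hn : exists n, 0 < s + INR (S n)).
  { exists (Z.to_nat (up (- s))). assert (H := pos_after_shift s).
    rewrite S_INR. lra. }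
  destruct Hn as [n Hn].
  (* The coefficients of the Taylor polynomial of the wave at 0. *)
  set (a m := (- r) ^ m * wave r th (d + INR m * th) 0 / INR (fact m)).
  set (P e := sum_f_R0 (fun m => a m * Rpower e (s + INR m)) n).
  set (K := r ^ S n / INR (fact (S n))).
  assert (Hfact : 0 < INR (fact (S n))) by apply INR_fact_lt_0.
  assert (Hbound : forall e, 0 < e ->
    Rabs (kernel s r th d e - P e) <= K * Rpower e (s + INR (S n))).
  { intros e He.
    assert (Hpow : forall m, Rpower e (s + INR m) = Rpower e s * e ^ m).
    { intros m. rewrite Rpower_plus, Rpower_pow by exact He. reflexivity. }
    destruct (Taylor_Lagrange (wave r th d) n 0 e He) as (z & Hz & Heq).
    { intros t _ m _. destruct m as [|m]; [exact I|].
      eexists. apply (Derive_n_wave r th (S m)). }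
    rewrite (is_derive_n_unique _ _ _ _ (Derive_n_wave r th (S n) d z)) in Heq.
    rewrite Rminus_0_r in Heq.
    replace (kernel s r th d e - P e)
      with (Rpower e (s + INR (S n)) * ((- r) ^ S n / INR (fact (S n)))
            * wave r th (d + INR (S n) * th) z).
    - rewrite !Rabs_mult, (Rabs_pos_eq (Rpower _ _)) by apply Rlt_le, exp_pos.
      unfold Rdiv. rewrite Rabs_mult, <- RPow_abs, Rabs_Ropp, (Rabs_pos_eq r) by lra.
      rewrite (Rabs_pos_eq (/ _)) by (apply Rlt_le, Rinv_0_lt_compat, Hfact).
      fold (Rdiv (r ^ S n) (INR (fact (S n)))). fold K.
      assert (HK : 0 < K) by (apply Rdiv_lt_0_compat; [now apply pow_lt|exact Hfact]).
      assert (Hw := Rabs_wave_le r th (d + INR (S n) * th) z).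
      assert (Hexp : exp (- (r * cos th * z)) <= 1).
      { apply exp_neg_le_1.
        apply Rmult_lt_0_compat; [apply Rmult_lt_0_compat|]; lra. }
      assert (0 < Rpower e (s + INR (S n)) * K)
        by (apply Rmult_lt_0_compat; [apply exp_pos|exact HK]).
      rewrite (Rmult_comm K). nra.
    - unfold kernel. rewrite Heq, Hpow.
      assert (HP : P e = Rpower e s * sum_f_R0
        (fun m => e ^ m / INR (fact m) * Derive_n (wave r th d) m 0) n).
      { unfold P. rewrite scal_sum. apply sum_eq. intros m _. unfold a.
        rewrite (is_derive_n_unique _ _ _ _ (Derive_n_wave r th m d 0)), Hpow.
        field. apply INR_fact_neq_0. }
      rewrite HP. field. lra. }
  destruct (has_polar_part_plus (fun e => RtoC (P e)) (fun e => RtoC (kernel s r th d e - P e)))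
    as (cs & Hcs & Hlim).
  - now apply has_polar_part_sum.
  - apply has_polar_part_of_vanishes.
    apply (vanishes_le (fun e => K * Rpower e (s + INR (S n)))).
    + generalize at_right_pos. apply filter_imp. intros e He.
      rewrite Cmod_R. now apply Hbound.
    + assert (HK0 : filterlim (fun t => K * t) (locally 0) (locally (K * 0))).
      { apply (ex_derive_continuous (fun t => K * t)). auto_derive. easy. }
      rewrite Rmult_0_r in HK0.
      apply (filterlim_comp _ _ _ (fun e => Rpower e (s + INR (S n))) (fun t => K * t)
        _ (locally 0));
        [now apply Rpower_lim_0|exact HK0].
  - exists cs. split; [exact Hcs|]. eapply vanishes_ext; [|exact Hlim].
    apply filter_forall. intros e. cbv beta.
    rewrite <- RtoC_plus. f_equal. f_equal. ring.
Qed.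

(** The condition of [is_laplace] for the whole integrand [g], with the values
    of the integrals named by a function [F] so that they can be added and
    scaled. *)
Definition finite_part (g : R -> C) (L : C) : Prop :=
  exists (F : R * R -> C) (cs : list (C * R)),
    (forall t, In t cs -> 0 < snd t) /\
    (forall e M, 0 < e -> 0 < M ->
       is_RInt (V := C_R_NormedModule) g e M (F (e, M) + power_sum cs e)%C) /\
    vanishes ends (fun b => F b - L)%C.

Lemma is_RInt_RtoC (f : R -> R) (e M I : R) :
  is_RInt f e M I -> is_RInt (V := C_R_NormedModule) (fun x => RtoC (f x)) e M (RtoC I).
Proof.
  intros H. apply (is_RInt_fct_extend_pair (U := R_NormedModule) (V := R_NormedModule)).
  - exact H.
  - simpl. assert (H0 := is_RInt_const (V := R_NormedModule) e M 0).
    unfold scal in H0; simpl in H0; unfold mult in H0; simpl in H0.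
    rewrite Rmult_0_r in H0. exact H0.
Qed.

Lemma is_RInt_Cscal (c : C) (g : R -> C) (e M : R) (I : C) :
  is_RInt (V := C_R_NormedModule) g e M I ->
  is_RInt (V := C_R_NormedModule) (fun x => c * g x)%C e M (c * I)%C.
Proof.
  intros H.
  assert (H1 := is_RInt_fct_extend_fst (U := R_NormedModule) (V := R_NormedModule) g e M I H).
  assert (H2 := is_RInt_fct_extend_snd (U := R_NormedModule) (V := R_NormedModule) g e M I H).
  apply (is_RInt_fct_extend_pair (U := R_NormedModule) (V := R_NormedModule)).
  - exact (is_RInt_minus _ _ _ _ _ _ (is_RInt_scal _ _ _ (fst c) _ H1)
             (is_RInt_scal _ _ _ (snd c) _ H2)).
  - exact (is_RInt_plus _ _ _ _ _ _ (is_RInt_scal _ _ _ (fst c) _ H2)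
             (is_RInt_scal _ _ _ (snd c) _ H1)).
Qed.

Lemma finite_part_plus (g h : R -> C) (L1 L2 : C) :
  finite_part g L1 -> finite_part h L2 ->
  finite_part (fun x => g x + h x)%C (L1 + L2)%C.
Proof.
  intros (F & cs & Hcs & HF & HL1) (G & ds & Hds & HG & HL2).
  exists (fun b => F b + G b)%C, (cs ++ ds). split; [|split].
  - intros t Ht. apply in_app_or in Ht. destruct Ht; auto.
  - intros e M He HM. rewrite power_sum_app.
    replace (F (e, M) + G (e, M) + (power_sum cs e + power_sum ds e))%C
      with ((F (e, M) + power_sum cs e) + (G (e, M) + power_sum ds e))%C by ring.
    exact (is_RInt_plus _ _ _ _ _ _ (HF e M He HM) (HG e M He HM)).
  - apply (vanishes_ext (fun b => (F b - L1) + (G b - L2))%C).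
    + apply filter_forall. intros b. ring.
    + now apply vanishes_plus.
Qed.

Lemma power_sum_scal (c : C) (cs : list (C * R)) (e : R) :
  power_sum (map (fun t => (c * fst t, snd t)%C) cs) e = (c * power_sum cs e)%C.
Proof.
  induction cs as [|t cs IH]; simpl; [ring|]. rewrite IH. ring.
Qed.

Lemma finite_part_scal (c : C) (g : R -> C) (L : C) :
  finite_part g L -> finite_part (fun x => c * g x)%C (c * L)%C.
Proof.
  intros (F & cs & Hcs & HF & HL).
  exists (fun b => c * F b)%C, (map (fun t => (c * fst t, snd t)%C) cs).
  split; [|split].
  - intros t Ht. apply in_map_iff in Ht. destruct Ht as [u [<- Hu]]. exact (Hcs u Hu).
  - intros e M He HM. rewrite power_sum_scal, <- Cmult_plus_distr_l.
    now apply is_RInt_Cscal, HF.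
  - apply (vanishes_ext (fun b => c * (F b - L))%C).
    + apply filter_forall. intros b. ring.
    + now apply vanishes_scal.
Qed.

Lemma finite_part_ext (g h : R -> C) (L : C) :
  (forall x, 0 < x -> g x = h x) -> finite_part g L -> finite_part h L.
Proof.
  intros Hgh (F & cs & Hcs & HF & HL). exists F, cs. split; [exact Hcs|].
  split; [|exact HL]. intros e M He HM.
  apply (is_RInt_ext (V := C_R_NormedModule) g); [|now apply HF].
  intros x Hx. apply Hgh, (between_pos e M); trivial. lra.
Qed.

Lemma finite_part_sum (g : nat -> R -> C) (L : nat -> C) (n : nat) :
  (forall m, (m <= n)%nat -> finite_part (g m) (L m)) ->
  finite_part (fun x => sum_n (fun m => g m x) n) (sum_n L n).
Proof.
  induction n as [|n IH]; intros H.
  - rewrite sum_O. apply (finite_part_ext (g 0%nat)); [|apply H; lia].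
    intros x _. now rewrite sum_O.
  - rewrite sum_Sn.
    apply (finite_part_ext (fun x => sum_n (fun m => g m x) n + g (S n) x)%C).
    + intros x _. now rewrite sum_Sn.
    + apply finite_part_plus; [apply IH; intros m Hm|]; apply H; lia.
Qed.

Lemma is_laplace_of_finite_part (f : R -> C) (a L : C) :
  finite_part (fun x => Cexp (- (a * RtoC x)) * f x)%C L -> is_laplace f a L.
Proof.
  intros (F & cs & Hcs & HF & HL). exists cs. split; [exact Hcs|].
  intros P HP. assert (HLP := filterlim_C_of_vanishes _ _ HL P HP).
  unfold filtermap in HLP. generalize (filter_and _ _ ends_ordered HLP).
  unfold filtermapi. apply filter_imp. intros [e M] [[He HM] H].
  exists (F (e, M)). split; [|exact H]. apply HF; simpl in *; lra.
Qed.

(** The integral of a derivative is a difference of boundary values: the one at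
    infinity vanishes and the one at 0 has only a polar part. *)
Lemma finite_part_kernel_derive (s r th d : R) :
  ~ Gamma_pole s -> 0 < r -> 0 < cos th ->
  finite_part (fun x => RtoC (s * kernel (s - 1) r th d x - r * kernel s r th (d + th) x))
    (RtoC 0).
Proof.
  intros Hs Hr Hcos.
  destruct (has_polar_part_kernel s r th d Hs Hr Hcos) as (cs & Hcs & Hlim).
  exists (fun b => RtoC (kernel s r th d (snd b))
                   + RtoC (-1) * (RtoC (kernel s r th d (fst b)) - power_sum cs (fst b)))%C,
    (map (fun t => (- fst t, snd t)%C) cs).
  split; [|split].
  - intros t Ht. apply in_map_iff in Ht. destruct Ht as [u [<- Hu]]. exact (Hcs u Hu).
  - intros e M He HM. rewrite power_sum_opp.
    replace (_ + _)%C with (RtoC (kernel s r th d M - kernel s r th d e)).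
    + now apply is_RInt_RtoC, is_RInt_kernel_derive.
    + simpl. rewrite RtoC_minus. ring.
  - apply (vanishes_ext (fun b => RtoC (kernel s r th d (snd b))
                   + RtoC (-1) * (RtoC (kernel s r th d (fst b)) - power_sum cs (fst b)))%C).
    + apply filter_forall. intros b. ring.
    + apply vanishes_plus; [|apply vanishes_scal].
      * apply (vanishes_le (fun b => Rpower (snd b) s * exp (- (r * cos th * snd b)))).
        -- apply filter_forall. intros b. rewrite Cmod_R. apply Rabs_kernel_le.
        -- apply (filterlim_comp _ _ _ snd (fun M => Rpower M s * exp (- (r * cos th * M)))
             _ (Rbar_locally p_infty));
             [apply filterlim_snd|].
           apply Rpower_exp_lim_infty. now apply Rmult_lt_0_compat.
      * intros eps. exact (filterlim_fst _ (Hlim eps)).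
Qed.

Lemma poch_S_l (x : R) (n : nat) : poch x (S n) = x * poch (x + 1) n.
Proof.
  induction n as [|n IH]; [simpl; ring|].
  change (poch x (S (S n))) with (poch x (S n) * (x + INR (S n))).
  rewrite IH, S_INR. simpl. ring.
Qed.

Lemma poch_neq_0 (x : R) (n : nat) : ~ Gamma_pole x -> poch x n <> 0.
Proof.
  intros Hx. induction n as [|n IH]; simpl; [lra|].
  apply Rmult_integral_contrapositive_currified; [exact IH|].
  intros H0. apply Hx. exists n. lra.
Qed.

(** Induction on a number [n] of integrations by parts that leads to a positive
    [s].  The value for [s] is r / s times the value for s + 1; the step shifts
    both the phase and [s * th] by [th], so the cosine is unchanged. *)
Lemma finite_part_kernel (n : nat) : forall s r th d,
  0 < s + INR n -> ~ Gamma_pole s -> 0 < r -> Rabs th < PI / 2 ->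
  finite_part (fun x => RtoC (kernel (s - 1) r th d x))
    (RtoC (Euler_Gamma (s + INR n) / poch s n * Rpower r (- s) * cos (d - s * th))).
Proof.
  induction n as [|n IH]; intros s r th d Hpos Hs Hr Hth.
  - simpl in *. rewrite Rplus_0_r in *.
    exists (fun b => RtoC (RInt (kernel (s - 1) r th d) (fst b) (snd b))), nil.
    split; [|split].
    + intros t [].
    + intros e M He HM. simpl. rewrite Cplus_0_r.
      apply is_RInt_RtoC, (RInt_correct (kernel (s - 1) r th d)). now apply ex_RInt_kernel.
    + apply vanishes_RtoC. rewrite Rdiv_1_r. now apply RInt_kernel_lim.
  - assert (Hs0 : s <> 0) by (intros H0; apply Hs; exists 0%nat; simpl; lra).
    assert (Hs1 : ~ Gamma_pole (s + 1)).
    { intros [m Hm]. apply Hs. exists (S m). rewrite S_INR. lra. }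
    rewrite S_INR in *.
    assert (Hcos : 0 < cos th) by (destruct (Rabs_def2 _ _ Hth); apply cos_gt_0; lra).
    assert (H1 := finite_part_kernel_derive s r th d Hs Hr Hcos).
    assert (H2 := IH (s + 1) r th (d + th) ltac:(lra) Hs1 Hr Hth).
    replace (s + 1 - 1) with s in H2 by ring.
    assert (H3 := finite_part_plus _ _ _ _ (finite_part_scal (RtoC (/ s)) _ _ H1)
                    (finite_part_scal (RtoC (r / s)) _ _ H2)).
    rewrite poch_S_l.
    replace (RtoC (Euler_Gamma (s + (INR n + 1)) / (s * poch (s + 1) n)
                   * Rpower r (- s) * cos (d - s * th)))
      with (RtoC (/ s) * RtoC 0 + RtoC (r / s) *
        RtoC (Euler_Gamma (s + 1 + INR n) / poch (s + 1) n * Rpower r (- (s + 1))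
              * cos (d + th - (s + 1) * th)))%C.
    + revert H3. apply finite_part_ext. intros x Hx.
      rewrite <- !RtoC_mult, <- RtoC_plus. f_equal. field. exact Hs0.
    + rewrite <- !RtoC_mult, <- RtoC_plus. f_equal.
      replace (d + th - (s + 1) * th) with (d - s * th) by ring.
      replace (s + (INR n + 1)) with (s + 1 + INR n) by ring.
      rewrite (Rpower_pred r (- s) Hr).
      replace (- (s + 1)) with (- s - 1) by ring.
      field. split; [now apply poch_neq_0|exact Hs0].
Qed.

(** * Complex powers and the Gamma function *)

(** The argument on the half-plane [0 < Re a]. *)
Definition arg (a : C) : R := atan (Im a / Re a).

Lemma arg_bound (a : C) : Rabs (arg a) < PI / 2.
Proof. unfold arg. destruct (atan_bound (Im a / Re a)). apply Rabs_def1; lra. Qed.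

Lemma cos_arg_pos (a : C) : 0 < cos (arg a).
Proof. destruct (Rabs_def2 _ _ (arg_bound a)). apply cos_gt_0; lra. Qed.

Lemma C_neq_0_of_Re (a : C) : 0 < Re a -> a <> RtoC 0.
Proof. intros Ha ->. simpl in Ha. lra. Qed.

(** The tangent of [arg a] determines the direction of [a] up to sign, and the
    sign is fixed by [0 < Re a] and [0 < cos (arg a)]. *)
Lemma polar_form (a : C) :
  0 < Re a -> a = (Cmod a * cos (arg a), Cmod a * sin (arg a)).
Proof.
  intros Ha. assert (Hcos := cos_arg_pos a).
  assert (Htan : sin (arg a) = cos (arg a) * (Im a / Re a)).
  { rewrite <- (tan_atan (Im a / Re a)). fold (arg a). unfold tan. field. lra. }
  assert (HIm : Im a * cos (arg a) = Re a * sin (arg a)).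
  { rewrite Htan. field. lra. }
  assert (Hmod := Cmod2_alt a). assert (Hpos := Cmod_ge_0 a).
  assert (Hone := sin2_cos2 (arg a)). unfold Rsqr in Hone.
  assert (HRe : Re a = Cmod a * cos (arg a)).
  { assert (Hsq : (Re a) ^ 2 = (Cmod a * cos (arg a)) ^ 2).
    { rewrite Rpow_mult_distr, Hmod.
      replace ((Re a ^ 2 + Im a ^ 2) * cos (arg a) ^ 2)
        with (Re a ^ 2 * cos (arg a) ^ 2 + (Im a * cos (arg a)) ^ 2) by ring.
      rewrite HIm.
      replace (Re a ^ 2 * cos (arg a) ^ 2 + (Re a * sin (arg a)) ^ 2)
        with (Re a ^ 2 * (sin (arg a) * sin (arg a) + cos (arg a) * cos (arg a))) by ring.
      rewrite Hone. ring. }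
    assert (0 <= Cmod a * cos (arg a)) by (apply Rmult_le_pos; lra).
    nra. }
  apply injective_projections; simpl; [exact HRe|].
  apply (Rmult_eq_reg_r (cos (arg a))); [|lra].
  change (snd a) with (Im a). rewrite HIm, HRe at 1. ring.
Qed.

Lemma Crpower_polar (a : C) (s : R) :
  Crpower a s = (RtoC (Rpower (Cmod a) s) * (cos (s * arg a), sin (s * arg a)))%C.
Proof.
  unfold Crpower, Cexp, Rpower. fold (arg a).
  replace (Re (RtoC s * (ln (Cmod a), arg a))) with (s * ln (Cmod a)) by (simpl; ring).
  replace (Im (RtoC s * (ln (Cmod a), arg a))) with (s * arg a) by (simpl; ring).
  apply injective_projections; simpl; ring.
Qed.

Lemma Crpower_plus (a : C) (s t : R) :
  Crpower a (s + t) = (Crpower a s * Crpower a t)%C.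
Proof.
  rewrite !Crpower_polar, Rpower_plus, Rmult_plus_distr_r, cos_plus, sin_plus.
  apply injective_projections; simpl; ring.
Qed.

Lemma Crpower_nat (a : C) (n : nat) : 0 < Re a -> Crpower a (INR n) = (a ^ n)%C.
Proof.
  intros Ha.
  assert (Hr : 0 < Cmod a) by (apply Cmod_gt_0, C_neq_0_of_Re, Ha).
  induction n as [|n IH].
  - rewrite Crpower_polar. simpl INR. rewrite Rmult_0_l, cos_0, sin_0, Rpower_O by exact Hr.
    apply injective_projections; simpl; ring.
  - rewrite S_INR, Crpower_plus, IH, Cpow_S, Cmult_comm. f_equal.
    rewrite Crpower_polar, Rmult_1_l, Rpower_1 by exact Hr.
    rewrite (polar_form a Ha) at 4. apply injective_projections; simpl; ring.
Qed.

Lemma Crpower_neq_0 (a : C) (s : R) : 0 < Re a -> Crpower a s <> RtoC 0.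
Proof.
  intros Ha H0. assert (H : Crpower a (s + - s) = RtoC 1).
  { replace (s + - s) with (INR 0) by (simpl; ring). now rewrite Crpower_nat. }
  rewrite Crpower_plus, H0, Cmult_0_l in H. apply RtoC_inj in H. lra.
Qed.

Lemma Cexp_wave (a : C) (x : R) :
  0 < Re a ->
  Cexp (- (a * RtoC x)) =
  (RtoC (wave (Cmod a) (arg a) 0 x)
   + Ci * RtoC (wave (Cmod a) (arg a) (- (PI / 2)) x))%C.
Proof.
  intros Ha. set (r := Cmod a). set (th := arg a).
  rewrite (polar_form a Ha). fold r th. unfold Cexp, wave.
  replace (Re (- ((r * cos th, r * sin th) * RtoC x))) with (- (r * cos th * x))
    by (simpl; ring).
  replace (Im (- ((r * cos th, r * sin th) * RtoC x))) with (0 - r * sin th * x)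
    by (simpl; ring).
  replace (- (PI / 2) - r * sin th * x) with (- (PI / 2 - (0 - r * sin th * x))) by ring.
  rewrite cos_neg, cos_shift.
  apply injective_projections; simpl; ring.
Qed.

(** The integrand is [kernel] of phase 0 plus [Ci] times [kernel] of phase
    [- (PI / 2)].  The integer [n] is any one with [0 < x + n], and not only the
    one chosen in the definition of [Gamma]. *)
Lemma finite_part_power_shift (a : C) (x : R) (n : nat) :
  0 < Re a -> 0 < x + INR n -> ~ Gamma_pole x ->
  finite_part (fun z => Cexp (- (a * RtoC z)) * RtoC (Rpower z (x - 1)))%C
    (RtoC (Euler_Gamma (x + INR n) / poch x n) * Crpower a (- x))%C.
Proof.
  intros Ha Hn Hx.
  assert (Hr : 0 < Cmod a) by (apply Cmod_gt_0, C_neq_0_of_Re, Ha).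
  assert (H1 := finite_part_kernel n x (Cmod a) (arg a) 0 Hn Hx Hr (arg_bound a)).
  assert (H2 := finite_part_kernel n x (Cmod a) (arg a) (- (PI / 2)) Hn Hx Hr (arg_bound a)).
  assert (H := finite_part_plus _ _ _ _ H1 (finite_part_scal Ci _ _ H2)).
  replace (_ * Crpower a (- x))%C with
    (RtoC (Euler_Gamma (x + INR n) / poch x n * Rpower (Cmod a) (- x) * cos (0 - x * arg a))
     + Ci * RtoC (Euler_Gamma (x + INR n) / poch x n * Rpower (Cmod a) (- x)
                  * cos (- (PI / 2) - x * arg a)))%C.
  - revert H. apply finite_part_ext. intros z Hz. rewrite Cexp_wave by exact Ha.
    unfold kernel. rewrite !RtoC_mult. ring.
  - rewrite Crpower_polar.
    replace (- (PI / 2) - x * arg a) with (- (PI / 2 - (- x * arg a))) by ring.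
    replace (0 - x * arg a) with (- x * arg a) by ring.
    rewrite cos_neg, cos_shift.
    apply injective_projections; simpl; ring.
Qed.

Lemma pos_not_pole (x : R) : 0 < x -> ~ Gamma_pole x.
Proof. intros Hx [n Hn]. assert (H := pos_INR n). lra. Qed.

(** Uniqueness of the transform of z^(x-1) at 1, computed with [n] integrations
    by parts and with none. *)
Lemma Euler_Gamma_shift (x : R) (n : nat) :
  0 < x -> Euler_Gamma (x + INR n) = poch x n * Euler_Gamma x.
Proof.
  intros Hx. assert (Hnp := pos_not_pole x Hx).
  assert (H1 : 0 < Re (RtoC 1)) by (simpl; lra).
  assert (Hn := pos_INR n).
  assert (Heq := is_laplace_unique _ _ _ _
    (is_laplace_of_finite_part _ _ _
      (finite_part_power_shift (RtoC 1) x n H1 ltac:(lra) Hnp))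
    (is_laplace_of_finite_part _ _ _
      (finite_part_power_shift (RtoC 1) x 0 H1 ltac:(simpl; lra) Hnp))).
  simpl in Heq. rewrite Rplus_0_r, Rdiv_1_r in Heq.
  assert (Hc := Crpower_neq_0 (RtoC 1) (- x) H1).
  assert (Hq : RtoC (Euler_Gamma (x + INR n) / poch x n) = RtoC (Euler_Gamma x)).
  { transitivity (RtoC (Euler_Gamma (x + INR n) / poch x n)
                  * Crpower 1 (- x) / Crpower 1 (- x))%C.
    - field. exact Hc.
    - rewrite Heq. field. exact Hc. }
  apply RtoC_inj in Hq. rewrite <- Hq. field. now apply poch_neq_0.
Qed.

Lemma Gamma_of_pos (x : R) : 0 < x -> Gamma x = Euler_Gamma x.
Proof.
  intros Hx. unfold Gamma.
  replace (Z.to_nat (up (- x))) with 0%nat.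
  - simpl. rewrite Rplus_0_r. field.
  - destruct (archimed (- x)) as [_ H].
    assert (Hlt : IZR (up (- x)) < 1) by lra. apply lt_IZR in Hlt. lia.
Qed.

Lemma Gamma_neq_0 (x : R) : ~ Gamma_pole x -> Gamma x <> 0.
Proof.
  intros Hx. unfold Gamma. apply Rmult_integral_contrapositive_currified.
  - destruct (Euler_Gamma_lim _ (pos_after_shift x)). lra.
  - now apply Rinv_neq_0_compat, poch_neq_0.
Qed.

Lemma Gamma_shift (x : R) (n : nat) : 0 < x -> Gamma (x + INR n) = poch x n * Gamma x.
Proof.
  intros Hx. assert (H := pos_INR n).
  rewrite !Gamma_of_pos by lra. now apply Euler_Gamma_shift.
Qed.

Lemma finite_part_power (a : C) (x : R) :
  0 < Re a -> ~ Gamma_pole x ->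
  finite_part (fun z => Cexp (- (a * RtoC z)) * RtoC (Rpower z (x - 1)))%C
    (RtoC (Gamma x) * Crpower a (- x))%C.
Proof.
  intros Ha Hx.
  exact (finite_part_power_shift a x (Z.to_nat (up (- x))) Ha (pos_after_shift x) Hx).
Qed.

(** * Terminating sums *)

Lemma sum_n_C_succ (g : nat -> C) (n : nat) :
  (sum_n g (S n) = sum_n g n + g (S n))%C.
Proof. exact (sum_Sn g n). Qed.

Lemma sum_n_C_ext (g h : nat -> C) (n : nat) :
  (forall m, (m <= n)%nat -> g m = h m) -> sum_n g n = sum_n h n :> C.
Proof. apply sum_n_ext_loc. Qed.

Lemma sum_n_Cmult_l (c : C) (g : nat -> C) (n : nat) :
  (c * sum_n g n)%C = sum_n (fun m => c * g m)%C n.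
Proof.
  induction n as [|n IH]; [now rewrite !sum_O|].
  rewrite !sum_n_C_succ, <- IH. apply Cmult_plus_distr_l.
Qed.

Lemma poch_neg_vanish (k n : nat) : (k < n)%nat -> poch (- INR k) n = 0.
Proof.
  intros Hkn. induction n as [|n IH]; [lia|]. simpl.
  destruct (Nat.eq_dec k n) as [->|Hne]; [ring|]. rewrite IH by lia. ring.
Qed.

Lemma poch_plus (x : R) (m n : nat) : poch x (m + n) = poch x m * poch (x + INR m) n.
Proof.
  induction n as [|n IH]; [rewrite Nat.add_0_r; simpl; ring|].
  rewrite Nat.add_succ_r. simpl. rewrite IH, plus_INR. ring.
Qed.

Lemma Re_sum_n (t : nat -> C) (n : nat) : Re (sum_n t n) = sum_n (fun m => Re (t m)) n.
Proof. induction n as [|n IH]; [now rewrite !sum_O|]. rewrite !sum_Sn, <- IH. reflexivity. Qed.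

Lemma Im_sum_n (t : nat -> C) (n : nat) : Im (sum_n t n) = sum_n (fun m => Im (t m)) n.
Proof. induction n as [|n IH]; [now rewrite !sum_O|]. rewrite !sum_Sn, <- IH. reflexivity. Qed.

Lemma Series_finite (t : nat -> R) (n : nat) :
  (forall m, (n < m)%nat -> t m = 0) -> Series t = sum_n t n.
Proof.
  intros Ht. apply is_series_unique.
  apply (filterlim_ext_loc (fun _ => sum_n t n)); [|apply filterlim_const].
  exists n. intros m Hm. induction Hm as [|m Hm IH]; [reflexivity|].
  rewrite sum_Sn, <- IH, Ht by lia. exact (eq_sym (Rplus_0_r _)).
Qed.

Lemma hyp2F1_terminating (k : nat) (b c : R) (x : C) :
  hyp2F1 (- INR k) b c x =
  sum_n (fun n => RtoC (poch (- INR k) n * poch b n / (poch c n * INR (fact n))) * x ^ n)%C k.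
Proof.
  set (t n := (RtoC (poch (- INR k) n * poch b n / (poch c n * INR (fact n))) * x ^ n)%C).
  assert (Ht : forall m, (k < m)%nat -> t m = RtoC 0).
  { intros m Hm. unfold t. rewrite poch_neg_vanish by exact Hm.
    unfold Rdiv. rewrite !Rmult_0_l. apply Cmult_0_l. }
  change (hyp2F1 (- INR k) b c x)
    with (Series (fun n => Re (t n)), Series (fun n => Im (t n))).
  rewrite !(Series_finite _ k) by (intros m Hm; now rewrite Ht).
  rewrite <- Re_sum_n, <- Im_sum_n. symmetry. apply surjective_pairing.
Qed.

(** The signed binomial coefficient (-1)^s C(m, s). *)
Definition binom_neg (m s : nat) : R := poch (- INR m) s / INR (fact s).

Lemma binom_neg_pascal (m s : nat) :
  binom_neg (S m) (S s) = binom_neg m (S s) - binom_neg m s.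
Proof.
  unfold binom_neg. rewrite (poch_S_l (- INR (S m))).
  replace (- INR (S m) + 1) with (- INR m) by (rewrite S_INR; ring).
  change (poch (- INR m) (S s)) with (poch (- INR m) s * (- INR m + INR s)).
  rewrite fact_simpl, mult_INR, !S_INR. field.
  split; [apply INR_fact_neq_0|]. assert (H := pos_INR s). lra.
Qed.

(** Pascal's rule telescopes: multiplication by [1 - u] raises [m] by one, up to
    the top-degree term, which is zero as soon as [m < n]. *)
Lemma sum_binom_neg_succ (m n : nat) (u : C) :
  sum_n (fun s => RtoC (binom_neg (S m) s) * u ^ s)%C n =
  ((1 - u) * sum_n (fun s => RtoC (binom_neg m s) * u ^ s) n
   + RtoC (binom_neg m n) * u ^ S n)%C :> C.
Proof.
  induction n as [|n IH].
  - rewrite !sum_O. unfold binom_neg. simpl. rewrite Rdiv_1_r. ring.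
  - rewrite !sum_n_C_succ, IH, binom_neg_pascal, RtoC_minus, !Cpow_S. ring.
Qed.

Lemma binomial_theorem_neg (m : nat) (u : C) : forall n, (m <= n)%nat ->
  sum_n (fun s => RtoC (binom_neg m s) * u ^ s)%C n = ((1 - u) ^ m)%C :> C.
Proof.
  induction m as [|m IH]; intros n Hmn.
  - induction n as [|n IHn].
    + rewrite sum_O. unfold binom_neg. simpl. rewrite Rdiv_1_r. ring.
    + rewrite sum_n_C_succ, IHn by lia. unfold binom_neg.
      rewrite poch_neg_vanish by lia. unfold Rdiv. rewrite Rmult_0_l, Cmult_0_l.
      apply Cplus_0_r.
  - rewrite sum_binom_neg_succ, IH by lia. unfold binom_neg at 1.
    rewrite poch_neg_vanish by lia. unfold Rdiv. rewrite Rmult_0_l, !Cpow_S. ring.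
Qed.

Lemma RtoC_neq_0 (x : R) : x <> 0 -> RtoC x <> RtoC 0.
Proof. intros Hx H. now apply Hx, RtoC_inj. Qed.

(** Both sides are d^(k-l) y^l: the signs of the left-hand side cancel. *)
Lemma Cpow_ratio (k l : nat) (d y : C) :
  (l <= k)%nat -> d <> RtoC 0 ->
  (RtoC ((-1) ^ k) * (- y) ^ l * (- d) ^ (k - l) = d ^ k * (y / d) ^ l)%C.
Proof.
  intros Hl Hd. replace k with (k - l + l)%nat at 1 3 by lia.
  rewrite RtoC_pow, !Cpow_add_r. unfold Cdiv.
  replace (- y)%C with (RtoC (-1) * y)%C by ring.
  replace (- d)%C with (RtoC (-1) * d)%C by ring.
  rewrite !Cpow_mult_l, Cpow_inv by exact Hd.
  assert (H1 : forall n, (RtoC (-1) ^ n * RtoC (-1) ^ n)%C = RtoC 1).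
  { intros n. rewrite <- Cpow_mult_l. replace (RtoC (-1) * RtoC (-1))%C with (RtoC 1) by ring.
    apply Cpow_1_l. }
  transitivity ((RtoC (-1) ^ (k - l) * RtoC (-1) ^ (k - l)) * (RtoC (-1) ^ l * RtoC (-1) ^ l)
                * y ^ l * d ^ (k - l))%C; [ring|].
  rewrite !H1. field. now apply Cpow_nz.
Qed.

(** * The transform of the polynomials *)

Lemma laplace_M_Konhauser (k v : nat) (p q : R) (a w y : C)
  (hGamma : forall s : nat, (s <= k)%nat -> ~ Gamma_pole (INR (v * s) - p - q + 1))
  (ha : 0 < Re a) :
  is_laplace
    (fun z : R => RtoC (Rpower z (- p - q)) * M_Konhauser k v p q y (w * RtoC z))%C
    a
    (sum_n (fun l => sum_n (fun s =>
      RtoC ((-1) ^ k * Gamma (INR k + q + 1))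
       * (RtoC (poch (- INR k) (l + s) * poch (INR k + 1 - p) l /
               (Gamma (INR l + q + 1) * Gamma (INR (v * s) - p - q + 1)
                * INR (fact l) * INR (fact s)))
          * (- y) ^ l * w ^ (v * s))
       * (RtoC (Gamma (INR (v * s) - p - q + 1))
          * Crpower a (- (INR (v * s) - p - q + 1)))) (k - l)) k)%C.
Proof.
  apply is_laplace_of_finite_part.
  eapply finite_part_ext; cycle 1.
  - apply finite_part_sum. intros l Hl. apply finite_part_sum. intros s Hs.
    apply finite_part_scal, finite_part_power; [exact ha|apply hGamma; lia].
  - intros z Hz. cbv beta. unfold M_Konhauser.
    rewrite Cmult_assoc, Cmult_assoc, sum_n_Cmult_l. apply sum_n_C_ext. intros l Hl.
    rewrite sum_n_Cmult_l. apply sum_n_C_ext. intros s Hs.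
    replace (INR (v * s) - p - q + 1 - 1) with (- p - q + INR (v * s)) by ring.
    rewrite Rpower_plus, Rpower_pow, Cpow_mult_l by exact Hz.
    rewrite (RtoC_mult (Rpower z _)), (RtoC_pow z).
    ring.
Qed.

Theorem theorem16 (k v : nat) (p q : R) (a w y : C)
  (hv : (1 <= v)%nat)
  (hp : p > 2 * INR k + 1)
  (hq : q > -1)
  (hGamma : forall s : nat, (s <= k)%nat -> ~ Gamma_pole (INR (v * s) - p - q + 1))
  (ha : Re a > 0)
  (hw : Cmod (w ^ v / a ^ v)%C < 1) :
  is_laplace
    (fun z : R => RtoC (Rpower z (- p - q)) * M_Konhauser k v p q y (w * RtoC z))%C
    a
    (RtoC (poch (q + 1) k) * Crpower a (p + q - 1)
     * ((w ^ v - a ^ v) / a ^ v) ^ k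
     * hyp2F1 (- INR k) (INR k + 1 - p) (q + 1) (y * a ^ v / (w ^ v - a ^ v)))%C.
Proof.
  assert (Ha : a <> RtoC 0) by now apply C_neq_0_of_Re.
  assert (Hav : (a ^ v)%C <> RtoC 0) by now apply Cpow_nz.
  set (u := (w ^ v / a ^ v)%C) in *. set (d := (u - 1)%C).
  assert (Hd : d <> RtoC 0).
  { intros H0. assert (Hu : u = RtoC 1).
    { replace u with (d + 1)%C by (unfold d; ring). rewrite H0. ring. }
    rewrite Hu, Cmod_1 in hw. lra. }
  assert (Hwv : (w ^ v - a ^ v)%C = (d * a ^ v)%C)
    by (unfold d, u; field; exact Hav).
  refine (eq_ind _ (is_laplace _ a)
            (laplace_M_Konhauser k v p q a w y hGamma ha) _ _).
  rewrite Hwv.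
  replace (d * a ^ v / a ^ v)%C with d by (field; exact Hav).
  replace (y * a ^ v / (d * a ^ v))%C with (y / d)%C by (field; now split).
  rewrite hyp2F1_terminating, sum_n_Cmult_l.
  apply sum_n_C_ext. intros l Hl.
  set (B := RtoC (poch (INR k + 1 - p) l * poch (- INR k) l
                  * poch (q + 1) k / (poch (q + 1) l * INR (fact l)))).
  (* Since (-k)_(l+s) = (-k)_l (l-k)_s, the sum over [s] is a binomial expansion
     with upper index [k - l]. *)
  transitivity (RtoC ((-1) ^ k) * Crpower a (p + q - 1) * (- y) ^ l * B
    * sum_n (fun s => RtoC (binom_neg (k - l) s) * u ^ s) (k - l))%C.
  - rewrite sum_n_Cmult_l. apply sum_n_C_ext. intros s Hs.
    assert (Hx := hGamma s ltac:(lia)).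
    set (x := INR (v * s) - p - q + 1) in *.
    assert (Hpow : Crpower a (- x) = (Crpower a (p + q - 1) / (a ^ v) ^ s)%C).
    { rewrite <- Cpow_mult_r, <- Crpower_nat by exact ha.
      replace (p + q - 1) with (- x + INR (v * s)) by (unfold x; ring).
      rewrite Crpower_plus. field. now apply Crpower_neq_0. }
    rewrite Hpow, poch_plus.
    replace (- INR k + INR l) with (- INR (k - l)) by (rewrite minus_INR by exact Hl; ring).
    replace (INR k + q + 1) with (q + 1 + INR k) by ring.
    replace (INR l + q + 1) with (q + 1 + INR l) by ring.
    rewrite !Gamma_shift by lra.
    assert (Hq : ~ Gamma_pole (q + 1)) by (apply pos_not_pole; lra).
    assert (HG := Gamma_neq_0 _ Hq). assert (HGx := Gamma_neq_0 _ Hx).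
    assert (Hpl := poch_neq_0 _ l Hq).
    assert (Hfl := INR_fact_neq_0 l). assert (Hfs := INR_fact_neq_0 s).
    change u with (w ^ v * / a ^ v)%C. unfold B, binom_neg.
    rewrite Cpow_mult_l, Cpow_inv, <- !Cpow_mult_r by exact Hav.
    unfold Rdiv. rewrite !RtoC_mult, !RtoC_inv, !RtoC_mult
      by (repeat first [assumption | apply Rmult_integral_contrapositive_currified]).
    field. repeat split; try apply RtoC_neq_0; try assumption.
    now apply Cpow_nz.
  - rewrite binomial_theorem_neg by lia.
    replace (1 - u)%C with (- d)%C by (unfold d; ring).
    transitivity (B * Crpower a (p + q - 1)
       * (RtoC ((-1) ^ k) * (- y) ^ l * (- d) ^ (k - l)))%C; [ring|].
    rewrite Cpow_ratio by assumption.
    replace B with (RtoC (poch (q + 1) k) * RtoC (poch (- INR k) l * poch (INR k + 1 - p) l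
                          / (poch (q + 1) l * INR (fact l))))%C; [ring|].
    unfold B. rewrite <- RtoC_mult. f_equal. unfold Rdiv. ring.
Qed.
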